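(* Let $(R, \mathfrak{m})$ and $(S, \mathfrak{n})$ be Noetherian local rings with a common residue class field $k=R/\mathfrak{m} = S/\mathfrak{n}$. Suppose that $\operatorname{depth} R>0$ and $\operatorname{depth} S > 0$. Then the fiber product $A = R\times_k S$ of $R$ and $S$ over $k$ is a weakly Arf ring if and only if both $R$ and $S$ are weakly Arf rings.
   Context: For a commutative ring $A$, $Q(A)$ denotes its total ring of fractions. A commutative ring $A$ is called weakly Arf if $yz/x \in A$ whenever $x,y,z\in A$ are such that $x$ is a non-zerodivisor on $A$ and $y/x, z/x \in Q(A)$ are integral over $A$. The fiber product is the subring $R\times_k S = \{(a,b)\in R\times S \mid f(a)=g(b)\}$ of $R \times S$, where $f:R\to k$ and $g:S\to k$ are the canonical surjections. *)

(* Defs.v *)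
From HB Require Import structures.
From mathcomp Require Import all_boot all_order all_algebra.
From mathcomp Require Import generic_quotient ring.
From mathcomp Require Import boolp classical_sets.

Set Implicit Arguments.
Unset Strict Implicit.
Unset Printing Implicit Defensive.

Import GRing.Theory.
Local Open Scope classical_set_scope.
Local Open Scope ring_scope.
Local Open Scope quotient_scope.

(* Total ring of fractions Q(A), obtained from the pairs (numerator,
   denominator) whose denominator is a non-zerodivisor.  In a commutative ring
   the non-zerodivisors are the left-regular elements [GRing.lreg]; 0 is not
   one of them, since A is nonzero. *)
Module TotalFraction.
Section TotalFraction.
Variable A : comNzRingType.

Record ratio := Ratio_ { frac :> A * A; _ : `[< GRing.lreg frac.2 >] }.

HB.instance Definition _ := [isSub for frac].
HB.instance Definition _ := [Choice of ratio by <:].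

Definition Ratio (a d : A) (d_reg : GRing.lreg d) : ratio :=
  @Ratio_ (a, d) (asboolT d_reg).

Lemma den_reg (x : ratio) : GRing.lreg x.2.
Proof. by case: x => ? /= /asboolP. Qed.
Arguments den_reg : clear implicits.

Definition equivf (x y : ratio) := x.1 * y.2 == x.2 * y.1.

Lemma equivf_refl : reflexive equivf.
Proof. by move=> x; rewrite /equivf mulrC. Qed.

Lemma equivf_sym : symmetric equivf.
Proof.
by move=> x y; rewrite /equivf eq_sym [x.2 * _]mulrC [x.1 * _]mulrC.
Qed.

Lemma equivf_trans : transitive equivf.
Proof.
move=> y x z; rewrite /equivf => /eqP xy /eqP yz; apply/eqP.
have /(_ (x.1 * z.2) (x.2 * z.1)) y_inj := den_reg y.
by apply: y_inj; ring: xy yz.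
Qed.

Canonical equivf_equiv := EquivRel equivf equivf_refl equivf_sym equivf_trans.

Definition type := {eq_quot equivf}.

HB.instance Definition _ : EqQuotient _ equivf type := EqQuotient.on type.
HB.instance Definition _ := Choice.on type.

Lemma piP (x y : ratio) :
  x.1 * y.2 = x.2 * y.1 <-> \pi_type x = \pi_type y.
Proof. by split=> [/eqP h|/eqmodP/eqP//]; apply/eqmodP. Qed.

Lemma reprE (x : ratio) :
  x.1 * (repr (\pi_type x)).2 = x.2 * (repr (\pi_type x)).1.
Proof. by apply/piP; rewrite reprK. Qed.

Definition embed (a : A) : type := \pi_type (Ratio a (@lreg1 A)).

Definition addr (x y : ratio) : ratio :=
  Ratio (x.1 * y.2 + y.1 * x.2) (lregM (den_reg x) (den_reg y)).
Definition oppr (x : ratio) : ratio := Ratio (- x.1) (den_reg x).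
Definition mulr (x y : ratio) : ratio :=
  Ratio (x.1 * y.1) (lregM (den_reg x) (den_reg y)).

(* Locked so that [addE], [oppE], [mulE] do not unify through nested terms. *)
Definition add (u v : type) : type :=
  locked (\pi_type (addr (repr u) (repr v))).
Definition opp (u : type) : type :=
  locked (\pi_type (oppr (repr u))).
Definition mul (u v : type) : type :=
  locked (\pi_type (mulr (repr u) (repr v))).

Lemma addE x y : add (\pi_type x) (\pi_type y) = \pi_type (addr x y).
Proof.
rewrite /add -lock; apply/esym/piP => /=; move: (reprE x) (reprE y).
move: (repr _) (repr _) => x' y' hx hy; ring: hx hy.
Qed.

Lemma oppE x : opp (\pi_type x) = \pi_type (oppr x).
Proof.
rewrite /opp -lock; apply/esym/piP => /=; move: (reprE x); move: (repr _) => x' hx; ring: hx.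
Qed.

Lemma mulE x y : mul (\pi_type x) (\pi_type y) = \pi_type (mulr x y).
Proof.
rewrite /mul -lock; apply/esym/piP => /=; move: (reprE x) (reprE y).
by move: (repr _) (repr _) => x' y' hx hy; rewrite mulrACA hx hy mulrACA.
Qed.

Lemma addA : associative add.
Proof.
elim/quotW=> x; elim/quotW=> y; elim/quotW=> z; rewrite !addE.
apply/piP => /=; ring.
Qed.

Lemma addC : commutative add.
Proof.
by elim/quotW=> x; elim/quotW=> y; rewrite !addE; apply/piP => /=; ring.
Qed.

Lemma add0 : left_id (embed 0) add.
Proof. by elim/quotW=> x; rewrite addE; apply/piP => /=; ring. Qed.

Lemma addN : left_inverse (embed 0) opp add.
Proof. by elim/quotW=> x; rewrite oppE addE; apply/piP => /=; ring. Qed.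

HB.instance Definition _ := GRing.isZmodule.Build type addA addC add0 addN.

Lemma mulA : associative mul.
Proof.
elim/quotW=> x; elim/quotW=> y; elim/quotW=> z; rewrite !mulE.
apply/piP => /=; ring.
Qed.

Lemma mulC : commutative mul.
Proof.
by elim/quotW=> x; elim/quotW=> y; rewrite !mulE; apply/piP => /=; ring.
Qed.

Lemma mul1 : left_id (embed 1) mul.
Proof. by elim/quotW=> x; rewrite mulE; apply/piP => /=; ring. Qed.

Lemma mulDl : left_distributive mul add.
Proof.
elim/quotW=> x; elim/quotW=> y; elim/quotW=> z.
by rewrite addE !mulE addE; apply/piP => /=; ring.
Qed.

Lemma embed_inj : injective embed.
Proof. by move=> a b /piP /=; rewrite mulr1 mul1r. Qed.

Lemma nonzero1 : embed 1 != embed 0.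
Proof. by apply/eqP => /embed_inj/eqP; rewrite oner_eq0. Qed.

HB.instance Definition _ :=
  GRing.Zmodule_isComNzRing.Build type mulA mulC mul1 mulDl nonzero1.

Definition is_unit : {pred type} := fun u => `[< exists v, v * u = 1 >].
Definition inv (u : type) : type := xget u [set v | v * u = 1].

Lemma mulVx : {in is_unit, left_inverse 1 inv *%R}.
Proof. by move=> u /asboolP u_unit; exact: (xgetPex u u_unit). Qed.

Lemma unitPl (u v : type) : v * u = 1 -> is_unit u.
Proof. by move=> vu; apply/asboolP; exists v. Qed.

Lemma inv_out : {in [predC is_unit], inv =1 id}.
Proof.
move=> u /negP u_out; rewrite /inv; case: xgetP => // v _ /unitPl.
by move/u_out.
Qed.

HB.instance Definition _ :=
  GRing.ComNzRing_hasMulInverse.Build type mulVx unitPl inv_out.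

Lemma embed_is_zmod_morphism : zmod_morphism embed.
Proof.
move=> a b; rewrite -[RHS]/(add (embed a) (opp (embed b))).
by rewrite oppE addE; apply/piP => /=; ring.
Qed.

Lemma embed_is_monoid_morphism : monoid_morphism embed.
Proof.
split=> // a b; rewrite -[RHS]/(mul (embed a) (embed b)) mulE.
by apply/piP => /=; ring.
Qed.

HB.instance Definition _ :=
  GRing.isZmodMorphism.Build A type embed embed_is_zmod_morphism.
HB.instance Definition _ :=
  GRing.isMonoidMorphism.Build A type embed embed_is_monoid_morphism.

End TotalFraction.
End TotalFraction.
HB.export TotalFraction.

Notation total_fraction := TotalFraction.type.

Definition to_total (A : comNzRingType) : {rmorphism A -> total_fraction A} :=
  @TotalFraction.embed A.

Section TotalFractionTheory.
Variable A : comNzRingType.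
Local Notation tot := (to_total A).

Lemma to_total_inj : injective (to_total A).
Proof. exact: TotalFraction.embed_inj. Qed.

Lemma to_total_unit (x : A) : GRing.lreg x -> tot x \is a GRing.unit.
Proof.
move=> x_reg; apply/unitrPr.
exists (\pi_(total_fraction A) (TotalFraction.Ratio 1 x_reg)).
by rewrite -[LHS]/(TotalFraction.mul _ _) TotalFraction.mulE;
   apply/TotalFraction.piP => /=; ring.
Qed.

Lemma total_fractionP (u : total_fraction A) :
  exists a x : A, GRing.lreg x /\ u = tot a / tot x.
Proof.
elim/quotW: u => r; exists r.1, r.2; have r2 := @TotalFraction.den_reg A r.
split=> //; apply: (mulIr (to_total_unit r2)); rewrite divrK ?to_total_unit //.
by rewrite -[LHS]/(TotalFraction.mul _ _) TotalFraction.mulE;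
   apply/TotalFraction.piP => /=; ring.
Qed.

End TotalFractionTheory.

Definition weakly_arf (A : comNzRingType) : Prop :=
  forall x y z : A, GRing.lreg x ->
    integralOver (to_total A) (to_total A y / to_total A x) ->
    integralOver (to_total A) (to_total A z / to_total A x) ->
  exists a : A, to_total A (y * z) / to_total A x = to_total A a.

Section Ideals.
Variable A : comNzRingType.

Definition ideal (I : set A) : Prop :=
  [/\ I 0, forall a b, I a -> I b -> I (a + b) & forall r a, I a -> I (r * a)].

Definition generated_ideal (s : seq A) : set A :=
  [set x | exists c : 'I_(size s) -> A, x = \sum_(i < size s) c i * s`_i].

Definition noetherian : Prop :=
  forall I : set A, ideal I -> exists s : seq A, I = generated_ideal s.

Definition maximal_ideal (I : set A) : Prop :=
  [/\ ideal I, I != setT &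
      forall J : set A, ideal J -> I `<=` J -> J = I \/ J = setT].

(* A is local with maximal ideal m. *)
Definition local_ring (m : set A) : Prop :=
  maximal_ideal m /\ forall J : set A, maximal_ideal J -> J = m.

Definition regular_sequence (s : seq A) : Prop :=
  (forall i, (i < size s)%N -> forall a,
     generated_ideal (take i s) (s`_i * a) -> generated_ideal (take i s) a) /\
  generated_ideal s != setT.

(* The depth of a Noetherian local ring (A, m) is [depth m], the maximal length
   of a regular sequence in m; it is finite.  Over other rings, [supremum]
   returns 0 if these lengths are unbounded. *)
Definition depth (m : set A) : nat :=
  supremum 0%N
    [set size s | s in [set s | regular_sequence s /\ {in s, forall x, m x}]].

End Ideals.

(* f : A -> k is the canonical surjection onto the residue field k = A / m. *)
Definition residue_map (A : comNzRingType) (m : set A) (k : fieldType)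
    (f : {rmorphism A -> k}) : Prop :=
  (forall c : k, exists a : A, f a = c) /\ (forall a : A, f a = 0 <-> m a).

Section FiberProduct.
Variables (R S : comNzRingType) (k : fieldType).
Variables (f : {rmorphism R -> k}) (g : {rmorphism S -> k}).

Definition fiber_pred : {pred R * S} := fun p => f p.1 == g p.2.

Lemma fiber_pred_subring : subring_closed fiber_pred.
Proof.
split=> [|p q|p q]; rewrite !unfold_in /= ?rmorph1 //.
- by move=> /eqP fgp /eqP fgq; rewrite !rmorphB fgp fgq.
- by move=> /eqP fgp /eqP fgq; rewrite !rmorphM fgp fgq.
Qed.

HB.instance Definition _ :=
  GRing.isSubringClosed.Build (R * S)%type fiber_pred fiber_pred_subring.

Record fiber_product :=
  FiberProduct { fiber_val :> R * S; _ : fiber_val \in fiber_pred }.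

HB.instance Definition _ := [isSub for fiber_val].
HB.instance Definition _ := [Choice of fiber_product by <:].
HB.instance Definition _ :=
  [SubChoice_isSubComNzRing of fiber_product by <:].

End FiberProduct.

(* Main.v *)
Require Import Defs.
From mathcomp Require Import all_boot all_order all_algebra.
From mathcomp Require Import boolp classical_sets.
From mathcomp Require Import ring.

(** Clearing denominators turns integrality of [y / x] into a homogeneous
    relation [y ^ n = \sum_(i < n) c i y ^ i x ^ (n - i)] inside the ring
    ([integralOver_fractionP]), so the weak Arf property says that [x] divides
    [y z] whenever [x] is regular and both [y] and [z] satisfy such a relation
    over [x] ([weakly_arfP]).  Relations of this form are transported by ring
    morphisms, and a morphism to a field that kills [x] also kills [y].

    Positive depth provides a regular element in each maximal ideal.
    Multiplying an annihilator by it puts the result in the ideals [m x 0] and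
    [0 x n] of the fiber product [A], so an element of [A] is regular exactly
    when both of its components are.

    If [R] and [S] are weakly Arf, the componentwise quotients [a] and [b] of
    [y z] by [x] exist, and what remains is that they have the same residue.
    When the residue of [x] is nonzero, that residue determines the ones of [a]
    and [b].  Otherwise [y] has residue zero, and since [a] is integral over the
    ideal generated by [y] ([integral_over_quotient]), so have [a] and [b].

    Conversely, let [A] be weakly Arf and [x], [y], [z] be given in [R].  If [x]
    is a unit, nothing has to be shown.  Otherwise [x], [y], [z] lie in [m], and
    for a regular [s] in [n] the elements [(x, s)], [(y, 0)], [(z, 0)] belong to
    [A].  An equation of [y] over [x] multiplied by [y] becomes an equation of
    [(y, 0)] over [(x, s)], because each of its terms vanishes in [S]; the
    quotient found in [A] has the required first component.  The case of [S]
    follows by exchanging the two factors. *)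

Set Implicit Arguments.
Unset Strict Implicit.
Unset Printing Implicit Defensive.

Import GRing.Theory.
Local Open Scope classical_set_scope.
Local Open Scope ring_scope.

(** * Integrality without denominators *)

(** This says that [y] is integral over the principal ideal generated by [x];
    it makes sense for all [x], which allows passing to quotients of the ring in
    which [x] stops being regular. *)
Definition integral_over_principal (A : comNzRingType) (x y : A) : Prop :=
  exists (d : nat) (c : nat -> A),
    y ^+ d = \sum_(i < d) c i * y ^+ i * x ^+ (d - i).

Lemma integralOver_fractionP (A : comNzRingType) (x y : A) : GRing.lreg x ->
  integralOver (to_total A) (to_total A y / to_total A x) <->
  integral_over_principal x y.
Proof.
move=> x_reg; have x_unit := to_total_unit x_reg.
set q := _ / _.
(* Multiplication by [x ^ d] clears the denominators in degree at most [d]. *)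
have clear_denom d i : (i <= d)%N ->
    q ^+ i * to_total A x ^+ d = to_total A (y ^+ i * x ^+ (d - i)).
  move=> le_id; rewrite rmorphM !rmorphXn -{1}(subnKC le_id) exprD mulrA.
  by rewrite -exprMn divrK.
have clear_sum d (c : nat -> A) :
    (\sum_(i < d) to_total A (c i) * q ^+ i) * to_total A x ^+ d =
    to_total A (\sum_(i < d) c i * y ^+ i * x ^+ (d - i)).
  rewrite mulr_suml rmorph_sum; apply: eq_bigr => i _.
  by rewrite -!mulrA clear_denom ?[RHS]rmorphM // ltnW.
have coef_tot (r : {poly A}) i :
    (map_poly (to_total A) r)`_i = to_total A r`_i by rewrite coef_map.
split=> [[p p_monic /rootP]|[d [c y_rel]]].
- have size_map : (size (map_poly (to_total A) p) <= size p)%N.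
    exact: size_poly.
  rewrite (horner_coef_wide _ size_map).
  have : p`_(size p).-1 = 1 by apply/eqP.
  have : (0 < size p)%N by rewrite size_poly_gt0 monic_neq0.
  case: (size p) => // d _; rewrite succnK => lead_p.
  rewrite big_ord_recr coef_tot lead_p.
  rewrite rmorph1 mul1r => /addr0_eq q_rel.
  pose c i := - p`_i; exists d, c; apply: (@to_total_inj A).
  rewrite -clear_sum -[y ^+ d]mulr1 -(expr0 x) -(subnn d) -clear_denom // -q_rel.
  congr (_ * _); rewrite -sumrN; apply: eq_bigr => i _.
  by rewrite /c coef_tot rmorphN mulNr.
- set r := \poly_(i < d) c i.
  have size_r : (size r <= d)%N := size_poly _ _.
  have size_map : (size (map_poly (to_total A) r) <= d)%N.
    exact: leq_trans (size_poly _ _) size_r.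
  exists ('X^d - r).
    by rewrite monicE lead_coefDl ?lead_coefXn // size_polyN size_polyXn ltnS.
  have -> : map_poly (to_total A) ('X^d - r) = 'X^d - map_poly (to_total A) r.
    by rewrite rmorphB /= map_polyXn.
  apply/rootP; rewrite hornerD hornerN hornerXn.
  rewrite (horner_coef_wide _ size_map); apply/eqP; rewrite subr_eq0; apply/eqP.
  apply: (mulIr (unitrX d x_unit)); rewrite clear_denom // subnn mulr1 y_rel.
  rewrite -clear_sum; congr (_ * _); apply: eq_bigr => i _.
  by rewrite coef_tot coef_poly ltn_ord.
Qed.

Lemma weakly_arfP (A : comNzRingType) :
  weakly_arf A <->
  forall x y z : A, GRing.lreg x ->
    integral_over_principal x y -> integral_over_principal x z ->
  exists a, y * z = x * a.
Proof.
have fracE x y z a : GRing.lreg x ->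
    to_total A (y * z) / to_total A x = to_total A a <-> y * z = x * a.
  move=> x_reg; have x_unit := to_total_unit x_reg; split=> [|->]; last first.
    by rewrite rmorphM mulrC mulKr.
  by move/(canRL (divrK x_unit)); rewrite -rmorphM [a * x]mulrC => /to_total_inj.
split=> arfA x y z x_reg.
- move=> /(integralOver_fractionP _ x_reg) x_y.
  move=> /(integralOver_fractionP _ x_reg) x_z.
  by have [a /(fracE _ _ _ _ x_reg) yz_xa] := arfA x y z x_reg x_y x_z; exists a.
- move=> /(integralOver_fractionP _ x_reg) x_y.
  move=> /(integralOver_fractionP _ x_reg) x_z.
  by have [a /(fracE _ _ _ _ x_reg) yz_xa] := arfA x y z x_reg x_y x_z; exists a.
Qed.

Lemma integral_over_rmorph (A B : comNzRingType) (h : {rmorphism A -> B})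
    (x y : A) :
  integral_over_principal x y -> integral_over_principal (h x) (h y).
Proof.
move=> [d [c y_rel]]; exists d, (h \o c); rewrite -rmorphXn y_rel rmorph_sum.
by apply: eq_bigr => i _; rewrite !rmorphM !rmorphXn.
Qed.

(** Applied in the residue field: if [y] is integral over the ideal generated by
    an element of the maximal ideal, then [y] lies in the maximal ideal. *)
Lemma integral_over_zero (k : fieldType) (y : k) :
  integral_over_principal 0 y -> y = 0.
Proof.
move=> [d [c y_rel]]; apply/eqP; have : y ^+ d == 0.
  by rewrite y_rel big1 // => i _; rewrite expr0n subn_eq0 leqNgt ltn_ord mulr0.
by rewrite expf_eq0 => /andP[].
Qed.

(** Since [a = y (z / x)], the equation of [z / x] multiplied by [y ^ d] is an
    equation of [a] over [y]. *)
Lemma integral_over_quotient (A : comNzRingType) (x y z a : A) :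
  GRing.lreg x -> integral_over_principal x z -> y * z = x * a ->
  integral_over_principal y a.
Proof.
move=> x_reg [d [c z_rel]] yz_xa; exists d, c; apply: (lregX (n := d) x_reg).
rewrite -exprMn -yz_xa exprMn z_rel !mulr_sumr; apply: eq_bigr => i _.
have split_pow (t : A) : t ^+ d = t ^+ i * t ^+ (d - i).
  by rewrite -exprD subnKC // ltnW.
have /(congr1 (fun t => t ^+ i)) := yz_xa; rewrite !exprMn => yz_xa_i.
by rewrite (split_pow x) (split_pow y); ring: yz_xa_i.
Qed.

(** * Regular elements and units in local rings *)

(** If all these regular sequences were empty, the supremum of their lengths
    would be zero. The first term of a nonempty one is regular modulo the ideal
    generated by no elements, which is zero. *)
Lemma depth_gt0_regular (A : comNzRingType) (m : set A) :
  (0 < depth m)%N -> exists2 x, m x & GRing.lreg x.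
Proof.
move=> depth_gt0.
have [s [[reg _] s_m] s_pos] : exists2 s : seq A,
    regular_sequence s /\ {in s, forall x, m x} & (0 < size s)%N.
  apply: contrapT => no_seq; move: depth_gt0; rewrite /depth.
  set L := image _ _; suff /subset_set1[->|->] : L `<=` [set 0%N].
  + by rewrite supremum0.
  + by rewrite supremum1.
  + move=> _ [s s_reg <-] /=; apply: contrapT => /eqP.
    by rewrite -lt0n => s_pos; apply: no_seq; exists s.
case: s reg s_m s_pos => // x s reg s_m _; exists x; first by apply: s_m; rewrite mem_head.
apply: mulrI0_lreg => a xa0; have [|c ->] := reg 0%N isT a.
  by exists (fun=> 0); rewrite /= big_ord0.
by rewrite big_ord0.
Qed.

(** Zorn's lemma puts a proper principal ideal into a maximal one, which is [m]
    because the ring is local. *)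
Lemma local_ring_notin_unit (A : comNzRingType) (m : set A) (x : A) :
  local_ring m -> ~ m x -> exists y, x * y = 1.
Proof.
move=> [_ m_unique] m'x; apply: contrapT => x_nonunit.
(* The empty set is admitted because the empty chain has an empty union. *)
pose P (J : set A) := J = set0 \/ [/\ ideal J, J x & ~ J 1].
have unionP (F : set (set A)) : F `<=` P -> total_on F subset ->
    P (\bigcup_(J in F) J).
  move=> FP F_chain; have [F0|] := pselect (forall J, F J -> J = set0).
    by left; apply/seteqP; split=> // a [J /F0 -> []].
  move=> /existsNP[J0 /not_implyP[FJ0 J0_n0]]; right.
  have [//|[[J00 _ _] J0x _]] := FP J0 FJ0; split; first split.
  - by exists J0.
  - move=> a b [J FJ Ja] [K FK Kb].
    have [JK|KJ] := F_chain J K FJ FK.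
    + have [K0|[[_ addK _] _ _]] := FP K FK; first by rewrite K0 in Kb.
      by exists K => //; apply: addK => //; apply: JK.
    + have [J_0|[[_ addJ _] _ _]] := FP J FJ; first by rewrite J_0 in Ja.
      by exists J => //; apply: addJ => //; apply: KJ.
  - move=> r a [J FJ Ja].
    have [J_0|[[_ _ mulJ] _ _]] := FP J FJ; first by rewrite J_0 in Ja.
    by exists J => //; apply: mulJ.
  - by exists J0.
  - by move=> [J FJ J1]; have [J_0|[]] := FP J FJ; first by rewrite J_0 in J1.
have [M [PM M_max]] := Zorn_bigcup unionP.
have P_xA : P [set x * a | a in setT].
  right; split; first split.
  - by exists 0 => //; rewrite mulr0.
  - by move=> _ _ [a _ <-] [b _ <-]; exists (a + b) => //; rewrite mulrDr.
  - by move=> r _ [a _ <-]; exists (r * a) => //; rewrite mulrCA.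
  - by exists 1 => //; rewrite mulr1.
  - by move=> [a _ xa1]; apply: x_nonunit; exists a.
case: PM => [M0|[M_ideal Mx M'1]].
  apply: (M_max _ _ P_xA); rewrite M0; split; first exact: sub0set.
  by move=> /(_ x); apply; exists 1 => //; rewrite mulr1.
suff M_m : M = m by apply: m'x; rewrite -M_m.
apply: m_unique; split=> // [|J J_ideal M_J].
  by apply/eqP => M_T; apply: M'1; rewrite M_T.
have [J1|J'1] := pselect (J 1).
  right; apply/seteqP; split=> // a _; rewrite -[a]mulr1.
  by have [_ _] := J_ideal; apply.
left; apply: contrapT => J_M; apply: (M_max J).
  by split=> // J_sub_M; apply: J_M; apply/seteqP.
by right; split=> //; exact: M_J.
Qed.

(** * Fiber products over a field *)

(** Describing the fiber product by its two projections makes the roles of the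
    factors symmetric, so that each argument is given for one factor only. *)
Definition is_pullback (R S A : comNzRingType) (k : fieldType)
    (f : {rmorphism R -> k}) (g : {rmorphism S -> k})
    (p : {rmorphism A -> R}) (q : {rmorphism A -> S}) : Prop :=
  [/\ forall a, f (p a) = g (q a),
      forall r s, f r = g s -> exists a, p a = r /\ q a = s &
      forall a b, p a = p b -> q a = q b -> a = b].

Section Pullback.
Variables (R S A : comNzRingType) (k : fieldType).
Variables (f : {rmorphism R -> k}) (g : {rmorphism S -> k}).
Variables (p : {rmorphism A -> R}) (q : {rmorphism A -> S}).
Hypothesis pb : is_pullback f g p q.

Lemma is_pullback_sym : is_pullback g f q p.
Proof.
have [pb_eq pb_lift pb_inj] := pb; split=> [a|s r /esym/pb_lift[a []]|a b ab ab'].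
- exact/esym.
- by exists a.
- exact: pb_inj.
Qed.

Lemma pullback_lreg (a : A) :
  GRing.lreg (p a) -> GRing.lreg (q a) -> GRing.lreg a.
Proof.
have [_ _ pb_inj] := pb => pa_reg qa_reg b c ab_ac; apply: pb_inj.
- by apply: pa_reg; rewrite -!rmorphM ab_ac.
- by apply: qa_reg; rewrite -!rmorphM ab_ac.
Qed.

(** If [p a] kills [r], then [a] kills the element [(u r, 0)] of [A]. *)
Lemma pullback_lreg_proj (u : R) (a : A) :
  f u = 0 -> GRing.lreg u -> GRing.lreg a -> GRing.lreg (p a).
Proof.
have [_ pb_lift pb_inj] := pb => fu0 u_reg a_reg; apply: mulrI0_lreg => r ar0.
have [|b [pb_b qb0]] := pb_lift (u * r) 0.
  by rewrite rmorphM fu0 mul0r rmorph0.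
have b0 : b = 0.
  apply: a_reg; rewrite mulr0; apply: pb_inj; rewrite rmorphM rmorph0.
    by rewrite pb_b mulrCA ar0 mulr0.
  by rewrite qb0 mulr0.
by apply: u_reg; rewrite -pb_b b0 rmorph0 mulr0.
Qed.

(** Multiplying the equation of [y] over [x] by [y] makes every term divisible
    by [y], so that the terms of its lift to [A] vanish in [S]. *)
Lemma pullback_integral_over (x y : R) (x' y' : A) :
  (forall c : k, exists s, g s = c) ->
  integral_over_principal x y -> p x' = x -> p y' = y -> q y' = 0 ->
  integral_over_principal x' y'.
Proof.
have [_ pb_lift pb_inj] := pb.
move=> g_surj [d [c y_rel]] px' py' qy'.
have [e pe] : {e : nat -> A & forall i, p (e i) = c i}.
  apply: (@choice _ _ (fun i a => p a = c i)) => i.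
  have [s gs] := g_surj (f (c i)).
  by have [//|a [pa _]] := pb_lift (c i) s; exists a.
(* The shift by one is the multiplication by [y]; it creates no term of
   degree zero in [y]. *)
exists d.+1, (fun i => if i is j.+1 then e j else 0); apply: pb_inj.
- rewrite big_ord_recl !mul0r add0r rmorph_sum rmorphXn py' exprS y_rel mulr_sumr.
  apply: eq_bigr => i _; rewrite !rmorphM !rmorphXn px' py' pe /= subSS exprS.
  ring.
- rewrite big_ord_recl !mul0r add0r rmorph_sum rmorphXn qy' expr0n big1 // => i _.
  by rewrite !rmorphM !rmorphXn qy' expr0n mulr0 mul0r.
Qed.

End Pullback.

(** When [x] lies in [m], integrality puts [y] and [z] there too, so that
    [(x, v)], [(y, 0)] and [(z, 0)] belong to [A]; the regular element [v] keeps
    [(x, v)] regular. Outside [m], [x] is a unit. *)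
Lemma pullback_weakly_arf_factor (R S A : comNzRingType) (k : fieldType)
    (m : set R) (f : {rmorphism R -> k}) (g : {rmorphism S -> k})
    (p : {rmorphism A -> R}) (q : {rmorphism A -> S}) (v : S) :
  is_pullback f g p q -> local_ring m -> residue_map m f ->
  (forall c : k, exists s, g s = c) -> g v = 0 -> GRing.lreg v ->
  weakly_arf A -> weakly_arf R.
Proof.
move=> pb m_local [_ f_ker] g_surj gv0 v_reg /weakly_arfP arfA.
have [_ pb_lift _] := pb.
apply/weakly_arfP => x y z x_reg x_y x_z.
have [/f_ker fx0|m'x] := pselect (m x); last first.
  have [t xt1] := local_ring_notin_unit m_local m'x.
  by exists (t * (y * z)); rewrite mulrA xt1 mul1r.
have f_zero w : integral_over_principal x w -> f w = 0.
  by move/(integral_over_rmorph f); rewrite fx0; apply: integral_over_zero.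
have [|x' [px' qx']] := pb_lift x v; first by rewrite fx0 gv0.
have [|y' [py' qy']] := pb_lift y 0; first by rewrite f_zero ?rmorph0.
have [|z' [pz' qz']] := pb_lift z 0; first by rewrite f_zero ?rmorph0.
have [|||a yz_xa] := arfA x' y' z'.
- by apply: (pullback_lreg pb); rewrite ?px' ?qx'.
- exact: (pullback_integral_over pb g_surj x_y).
- exact: (pullback_integral_over pb g_surj x_z).
by exists (p a); rewrite -px' -py' -pz' -!rmorphM yz_xa.
Qed.

(** What has to be shown is that the quotients [a] and [b] found in the two
    factors have the same residue. *)
Lemma pullback_weakly_arf (R S A : comNzRingType) (k : fieldType)
    (f : {rmorphism R -> k}) (g : {rmorphism S -> k})
    (p : {rmorphism A -> R}) (q : {rmorphism A -> S}) (u : R) (v : S) :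
  is_pullback f g p q ->
  f u = 0 -> GRing.lreg u -> g v = 0 -> GRing.lreg v ->
  weakly_arf R -> weakly_arf S -> weakly_arf A.
Proof.
move=> pb fu0 u_reg gv0 v_reg /weakly_arfP arfR /weakly_arfP arfS.
have [pb_eq pb_lift pb_inj] := pb.
apply/weakly_arfP => x y z x_reg x_y x_z.
have px_reg := pullback_lreg_proj pb fu0 u_reg x_reg.
have qx_reg := pullback_lreg_proj (is_pullback_sym pb) gv0 v_reg x_reg.
have px_z := integral_over_rmorph p x_z; have qx_z := integral_over_rmorph q x_z.
have [a yz_xa] := arfR _ _ _ px_reg (integral_over_rmorph p x_y) px_z.
have [b yz_xb] := arfS _ _ _ qx_reg (integral_over_rmorph q x_y) qx_z.
suff /pb_lift[c [pc qc]] : f a = g b.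
  by exists c; apply: pb_inj; rewrite !rmorphM ?pc ?qc.
have [fx0|fx_n0] := eqVneq (f (p x)) 0.
- (* Here [a] is integral over [y], whose residue is zero. *)
  have fy0 : f (p y) = 0.
    have := integral_over_rmorph f (integral_over_rmorph p x_y).
    by rewrite fx0; apply: integral_over_zero.
  have gy0 : g (q y) = 0 by rewrite -pb_eq.
  have := integral_over_rmorph f (integral_over_quotient px_reg px_z yz_xa).
  rewrite fy0 => /integral_over_zero ->.
  have := integral_over_rmorph g (integral_over_quotient qx_reg qx_z yz_xb).
  by rewrite gy0 => /integral_over_zero ->.
- apply: (mulfI fx_n0).
  rewrite -[LHS]rmorphM -yz_xa pb_eq -[RHS]rmorphM -yz_xb.
  by rewrite !rmorphM !pb_eq.
Qed.

Theorem theorem1p5 (R S : comNzRingType) (k : fieldType)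
    (m : set R) (n : set S)
    (f : {rmorphism R -> k}) (g : {rmorphism S -> k}) :
  noetherian R -> local_ring m ->
  noetherian S -> local_ring n ->
  residue_map m f -> residue_map n g ->
  (0 < depth m)%N -> (0 < depth n)%N ->
  weakly_arf (fiber_product f g) <-> weakly_arf R /\ weakly_arf S.
Proof.
move=> _ m_local _ n_local f_res g_res.
move=> /depth_gt0_regular[u mu u_reg] /depth_gt0_regular[v nv v_reg].
have [f_surj f_ker] := f_res; have [g_surj g_ker] := g_res.
have fu0 : f u = 0 by apply/f_ker.
have gv0 : g v = 0 by apply/g_ker.
pose p : {rmorphism fiber_product f g -> R} := fst \o val.
pose q : {rmorphism fiber_product f g -> S} := snd \o val.
have pb : is_pullback f g p q.
  split=> [[a a_fib]|r s frs|a b ab1 ab2]; first exact/eqP.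
  - have rs_fib : (r, s) \in fiber_pred f g by apply/eqP.
    by exists (FiberProduct rs_fib).
  - by apply: val_inj; apply: injective_projections.
split=> [arfA|[arfR arfS]]; last first.
  exact: (pullback_weakly_arf pb fu0 u_reg gv0 v_reg).
split.
- exact: (pullback_weakly_arf_factor pb m_local f_res g_surj gv0 v_reg).
- exact: (pullback_weakly_arf_factor (is_pullback_sym pb) n_local g_res f_surj
    fu0 u_reg).
Qed.
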